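(* Let $E=(E,P,L,d)$ be a fractional Brauer configuration, and consider the conditions: (f7) for all standard sequences $p\equiv q$ of $E$, $[[{}^\wedge p]^\wedge]=[[{}^\wedge q]^\wedge]$; (sf7) for any two nonzero relations $p-q$ and $p'-q'$ of type 1 in $I_E$, if $pp'$, $qp'$ and $pq'$ are all special paths in $Q_E$, then so is $qq'$. Then (f7) implies (sf7). Moreover, if $E$ is symmetric, then (sf7) also implies (f7).
   Context: Paths are written from right to left ($pp'$ means first $p'$, then $p$). Let $k$ be a field. **f-BC.** A fractional Brauer configuration (f-BC) is a quadruple $E=(E,P,L,d)$ where $E$ is a $G$-set for $G=\langle g\rangle\cong(\mathbb Z,+)$, $P$ and $L$ are partitions of $E$ ($P(e)$, $L(e)$ denote the classes containing $e$), and $d:E\to\mathbb Z_{+}$ is a function to the positive integers, such that: (f1) $L(e)\subseteq P(e)$ and $P(e)$ is finite for each $e$; (f2) $L(e_1)=L(e_2)$ implies $P(g(e_1))=P(g(e_2))$; (f3) $d$ is constant on $\langle g\rangle$-orbits; (f4) $P(e_1)=P(e_2)$ iff $P(g^{d(e_1)}(e_1))=P(g^{d(e_2)}(e_2))$; (f5) $L(e_1)=L(e_2)$ iff $L(g^{d(e_1)}(e_1))=L(g^{d(e_2)}(e_2))$; (f6) for all $e,h\in E$ the formal sequence $L(g^{d(e)-1}(e))\cdots L(g(e))L(e)$ is not a proper subsequence (of consecutive terms) of $L(g^{d(h)-1}(h))\cdots L(g(h))L(h)$. $E$ is symmetric if $g^{d(e)}(e)=e$ for all $e\in E$. **Quiver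 and type 1 relations.** $Q_E$ has vertices the classes $P(e)$ and arrows the classes $L(e)$, where $L(e)$ goes from $P(e)$ to $P(g(e))$. The path $L(g^{d(e)-1}(e))\cdots L(g(e))L(e)$ is the special path starting at $e$. The ideal $I_E$ of $kQ_E$ is generated by: (R1) $L(g^{d(e)-1-j}(e))\cdots L(g(e))L(e)-L(g^{d(h)-1-j}(h))\cdots L(g(h))L(h)$, if $P(e)=P(h)$, $j\ge 0$ (with $j<d(e)$, $j<d(h)$ so that the expression makes sense), and $L(g^{d(e)-i}(e))=L(g^{d(h)-i}(h))$ for $1\le i\le j$; (R2) $L(e_n)\cdots L(e_1)$, if $P(g(e_i))=P(e_{i+1})$ for $1\le i\le n-1$ and $\bigcap_{i=1}^n g^{n-i}(L(e_i))=\emptyset$; (R3) $L(g^{n-1}(e))\cdots L(e)$ for $n>d(e)$. Relations (R1) are called relations of type 1; such a relation $p-q$ is nonzero if $p\neq q$ as paths in $Q_E$. **Standard sequences.** A standard sequence is $p=(g^{n-1}(e),\dots,g(e),e)$ with $e\in E$, $0\le n\le d(e)$ (for $n=0$ the trivial sequence $()_e$). Put ${}^\wedge p=(g^{d(e)-1}(e),\dots,g^n(e))$ if $0<n<d(e)$, ${}^\wedge p=()_{g^{d(e)}(e)}$ if $n=d(e)$, ${}^\wedge p=(g^{d(e)-1}(e),\dots,e)$ if $n=0$; and $p^\wedge=(g^{-1}(e),\dots,g^{n-d(e)}(e))$ if $0<n<d(e)$, $p^\wedge=()_e$ if $n=d(e)$, $p^\wedge=(g^{-1}(e),\dots,g^{-d(e)}(e))$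 if $n=0$. Put $L(p)=L(g^{n-1}(e))\cdots L(e)$ for $n>0$ and $L(()_e)=e_{P(e)}$ (the trivial path at $P(e)$). Write $p\equiv q$ if $L(p)=L(q)$. For a set $\mathcal X$ of standard sequences (a single sequence being viewed as a one-element set), $[\mathcal X]$ is the set of standard sequences $q$ with $q\equiv p$ for some $p\in\mathcal X$, and $\mathcal X^\wedge=\{p^\wedge\mid p\in\mathcal X\}$. *)

(* Defs.v *)
From HB Require Import structures.
From mathcomp Require Import all_boot all_order all_algebra.
From mathcomp Require Import all_classical.

Set Implicit Arguments.
Unset Strict Implicit.
Unset Printing Implicit Defensive.
Import GRing.Theory.

Local Open Scope classical_set_scope.

(* The class of [e] in a set [X] of classes; it is "the" class containing [e]
   when [X] is a partition. *)
Definition class_of (T : Type) (X : set (set T)) (e : T) : set T :=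
  pblock X id e.

(* Sequences of classes are listed in the order in which paths are written:
   the term of the highest power of g comes first, the term of e comes last. *)
Definition class_seq (T : Type) (gact : int -> T -> T) (X : set (set T))
    (e : T) (n : nat) : seq (set T) :=
  [seq class_of X (gact (Posz i) e) | i <- rev (iota 0 n)].

(* Fractional Brauer configurations.  [gact m e] is g^m(e), for the action of
   the infinite cyclic group <g>, written additively as [int]. *)
Record fBC : Type := FBC {
  carrier :> Type;
  gact : int -> carrier -> carrier;
  Pset : set (set carrier);
  Lset : set (set carrier);
  deg : carrier -> nat;
  gact0 : forall e, gact 0%R e = e;
  gactD : forall m n e, gact (m + n)%R e = gact m (gact n e);
  Pset_partition : partition Pset id [set: carrier];
  Lset_partition : partition Lset id [set: carrier];
  deg_gt0 : forall e, 0 < deg e;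
  fBC1 : forall e,
    class_of Lset e `<=` class_of Pset e /\ finite_set (class_of Pset e);
  fBC2 : forall e1 e2, class_of Lset e1 = class_of Lset e2 ->
    class_of Pset (gact 1%R e1) = class_of Pset (gact 1%R e2);
  fBC3 : forall (m : int) e, deg (gact m e) = deg e;
  fBC4 : forall e1 e2,
    class_of Pset e1 = class_of Pset e2 <->
    class_of Pset (gact (deg e1) e1) = class_of Pset (gact (deg e2) e2);
  fBC5 : forall e1 e2,
    class_of Lset e1 = class_of Lset e2 <->
    class_of Lset (gact (deg e1) e1) = class_of Lset (gact (deg e2) e2);
  fBC6 : forall e h,
    ~ (infix (class_seq gact Lset e (deg e)) (class_seq gact Lset h (deg h)) /\
       class_seq gact Lset e (deg e) <> class_seq gact Lset h (deg h))
}.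

Arguments gact {f}.
Arguments Pset {f}.
Arguments Lset {f}.
Arguments deg {f}.

Definition Pcl (E : fBC) (e : E) : set E := class_of Pset e.
Definition Lcl (E : fBC) (e : E) : set E := class_of Lset e.

Definition symmetric_fBC (E : fBC) : Prop := forall e : E, gact (deg e) e = e.

(* A path of the quiver Q_E, whose vertices are the classes P(e) and whose
   arrows are the classes L(e) : P(e) -> P(g(e)), is recorded by its source,
   its arrows (written from right to left: the first one traversed is the last
   of the list) and its target.  The type also has elements that are not paths
   of Q_E, but only the paths [Lpath e n] and their products occur below. *)
Record qpath (E : fBC) : Type := QPath {
  psource : set E;
  parrows : seq (set E);
  ptarget : set E
}.

(* The path L(g^(n-1)(e)) ... L(g(e)) L(e), trivial at P(e) if n = 0. *)
Definition Lpath (E : fBC) (e : E) (n : nat) : qpath E :=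
  QPath (Pcl e) (class_seq gact Lset e n) (Pcl (gact n e)).

(* [qmul p p'] is pp', i.e. first p', then p; [None] stands for the product 0
   of two paths that cannot be composed. *)
Definition qmul (E : fBC) (p p' : qpath E) : option (qpath E) :=
  if ptarget p' == psource p
  then Some (QPath (psource p') (parrows p ++ parrows p') (ptarget p))
  else None.

Definition special_path (E : fBC) (r : option (qpath E)) : Prop :=
  exists e : E, r = Some (Lpath e (deg e)).

(* [type1_relation p q]: p - q is one of the generators (R1) of I_E.  Such a
   relation is represented by the pair of paths (p, q). *)
Definition type1_relation (E : fBC) (p q : qpath E) : Prop :=
  exists (e h : E) (j : nat),
    [/\ Pcl e = Pcl h,
        j < deg e /\ j < deg h,
        forall i : nat, 1 <= i <= j ->
          Lcl (gact ((deg e)%:Z - i%:Z)%R e) = Lcl (gact ((deg h)%:Z - i%:Z)%R h),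
        p = Lpath e (deg e - j)
      & q = Lpath h (deg h - j)].

Definition nonzero_type1_relation (E : fBC) (p q : qpath E) : Prop :=
  type1_relation p q /\ p <> q.

(* The sequence (g^(n-1)(e), ..., g(e), e) is encoded by the pair (e, n), and
   ()_e by (e, 0); this is faithful since a nonempty sequence determines its
   last term e and its length n. *)
Record prestd (E : fBC) : Type := PreStd { sbase : E; slen : nat }.

Definition standard (E : fBC) (p : prestd E) : Prop := slen p <= deg (sbase p).

(* ^p and p^.  The three cases of the usual definition (n = 0, 0 < n < d(e),
   n = d(e)) are covered by a single formula, because g^0(e) = e and the pair
   (f, 0) encodes ()_f. *)
Definition lhat (E : fBC) (p : prestd E) : prestd E :=
  PreStd (gact (slen p) (sbase p)) (deg (sbase p) - slen p).

Definition rhat (E : fBC) (p : prestd E) : prestd E :=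
  PreStd (gact ((slen p)%:Z - (deg (sbase p))%:Z)%R (sbase p))
         (deg (sbase p) - slen p).

Definition std_path (E : fBC) (p : prestd E) : qpath E := Lpath (sbase p) (slen p).

Definition std_equiv (E : fBC) (p q : prestd E) : Prop := std_path p = std_path q.

Definition std_closure (E : fBC) (X : set (prestd E)) : set (prestd E) :=
  [set q | standard q /\ exists2 p, X p & std_equiv q p].

Definition f7 (E : fBC) : Prop :=
  forall p q : prestd E, standard p -> standard q -> std_equiv p q ->
    std_closure (@rhat E @` std_closure [set lhat p]) =
    std_closure (@rhat E @` std_closure [set lhat q]).

Definition sf7 (E : fBC) : Prop :=
  forall p q p' q' : qpath E,
    nonzero_type1_relation p q -> nonzero_type1_relation p' q' ->
    special_path (qmul p p') -> special_path (qmul q p') ->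
    special_path (qmul p q') -> special_path (qmul q q').

(* Main.v *)
From mathcomp Require Import all_boot all_order all_algebra.
From mathcomp Require Import all_classical.
From mathcomp Require Import zify.
Require Import Defs.

Set Implicit Arguments.
Unset Strict Implicit.
Unset Printing Implicit Defensive.

Local Open Scope classical_set_scope.

(** The argument rests on reading (f7) in terms of special paths. For standard
    sequences s, the product L(s)L(s^) is the special path starting at the base
    of s^, and conversely a product of two paths that is special splits as
    L(s)L(s^) for a standard s. Hence [[^p]^] is the set of standard t for which
    L(^p)L(t) is special, and (f7) says: if L(p) = L(q), then L(^p)L(t) is
    special exactly when L(^q)L(t) is ([mem_complement_closure]).

    In this form (f7) => (sf7) is immediate. If pp', qp' and pq' are special,
    the first two products split along standard sequences a and b with
    L(a) = L(b) = p', L(^a) = p and L(^b) = q, so by (f7) the path q' is a right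
    complement of q because it is one of p.

    For the converse, suppose L(p) = L(q) and L(^p)L(t) is special; then
    L(^p)L(p), L(^q)L(p) and L(^p)L(t) are special, which is the situation of
    (sf7) for the pairs L(^p), L(^q) and L(p), L(t). In a symmetric
    configuration both pairs are relations of type 1 or are trivial: g^d(e)
    fixes e, so the left complement of a standard sequence p based at e consists
    of the last arrows before the special path at e closes up, and (R1) is
    exactly the operation of cancelling such arrows when two special paths share
    them ([equiv_or_type1_of_equiv_lhat]). When one of the
    two relations is zero the conclusion holds outright. Condition (f6) enters
    only to exclude that a special path is a proper piece of another, which is
    what keeps the lengths in (R1) positive. *)

(** * Classes *)

Lemma mem_class_of (T : Type) (X : set (set T)) (e : T) :
  partition X id [set: T] -> X (class_of X e) /\ class_of X e e.
Proof.
move=> [covX _ _].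
have: cover X id e by rewrite covX.
move=> [A XA Ae].
rewrite /class_of /pblock /pblock_index.
by case: (@getPex (set T) (fun i => X i /\ i e)) => [|XB Be]; first by exists A.
Qed.

Lemma class_of_eq (T : Type) (X : set (set T)) (e h : T) :
  partition X id [set: T] -> class_of X e h -> class_of X e = class_of X h.
Proof.
move=> partX eh.
have [Xe _] := mem_class_of e partX; have [Xh hh] := mem_class_of h partX.
by case: partX => _ + _; apply=> //; exists h.
Qed.

Lemma Pcl_of_Lcl (E : fBC) (e h : E) : Lcl e = Lcl h -> Pcl e = Pcl h.
Proof.
move=> eh; apply: class_of_eq; first exact: Pset_partition.
have [sub _] := fBC1 e; apply: sub.
rewrite -[class_of _ _]/(Lcl e) eh.
by have [] := mem_class_of h (@Lset_partition E).
Qed.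

Lemma Pcl_gact_deg (E : fBC) (e h : E) :
  Pcl e = Pcl h -> Pcl (gact (deg e) e) = Pcl (gact (deg h) h).
Proof. by move=> eh; apply/(fBC4 e h). Qed.

(** * Paths along the action *)

Lemma gact_nat (E : fBC) (m n : nat) (e : E) :
  gact m (gact n e) = gact (m + n)%N e.
Proof. by rewrite -gactD. Qed.

Lemma size_class_seq (E : fBC) X (e : E) n : size (class_seq gact X e n) = n.
Proof. by rewrite size_map size_rev size_iota. Qed.

Lemma class_seqD (E : fBC) X (e : E) m n :
  class_seq gact X e (m + n) =
  class_seq gact X (gact n e) m ++ class_seq gact X e n.
Proof.
rewrite /class_seq addnC iotaD rev_cat map_cat add0n; congr (_ ++ _).
rewrite -[in iota n m](addn0 n) iotaDl -map_rev -map_comp; apply: eq_map => i /=.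
by rewrite gact_nat addnC.
Qed.

Lemma class_seq_eqP (E : fBC) X (e h : E) n :
  class_seq gact X e n = class_seq gact X h n <->
  forall i : nat, i < n -> class_of X (gact i e) = class_of X (gact i h).
Proof.
rewrite /class_seq; split.
  by move=> /eq_in_map eq_eh i i_n; apply: eq_eh; rewrite mem_rev mem_iota.
by move=> eq_eh; apply/eq_in_map => i; rewrite mem_rev mem_iota => /eq_eh.
Qed.

Lemma Lpath_eq_len (E : fBC) (e h : E) m n : Lpath e m = Lpath h n -> m = n.
Proof.
by case=> _ /(congr1 size) + _; rewrite !size_class_seq.
Qed.

Lemma Lpath_eq_Lcl (E : fBC) (e h : E) n i :
  Lpath e n = Lpath h n -> i < n -> Lcl (gact i e) = Lcl (gact i h).
Proof. by case=> _ /class_seq_eqP eqL _; apply: eqL. Qed.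

(** The vertex reached after the arrows of a nonempty path is determined by its
    last arrow, by (f2). *)
Lemma Pcl_gact_of_class_seq (E : fBC) (e h : E) n :
  Pcl e = Pcl h -> class_seq gact Lset e n = class_seq gact Lset h n ->
  Pcl (gact n e) = Pcl (gact n h).
Proof.
case: n => [|n] Peh; first by rewrite !gact0.
move=> /class_seq_eqP /(_ n (ltnSn n)) /fBC2.
by rewrite -!gactD.
Qed.

Lemma qmul_Lpath (E : fBC) (e : E) (m n : nat) :
  qmul (Lpath (gact n e) m) (Lpath e n) = Some (Lpath e (m + n)).
Proof. by rewrite /qmul /= eqxx /Lpath class_seqD gact_nat. Qed.

(** * Special products and complements *)

Lemma special_qmul_Lpath (E : fBC) (e : E) (m n : nat) :
  m + n = deg e -> special_path (qmul (Lpath (gact n e) m) (Lpath e n)).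
Proof. by move=> mn; exists e; rewrite qmul_Lpath mn. Qed.

(** The arrows of a special product already fix how it splits: cutting the
    special path after n arrows recovers both factors, the vertex at the cut
    being given by [Pcl_gact_of_class_seq]. *)
Lemma special_qmul_split (E : fBC) (x y : E) (m n : nat) :
  special_path (qmul (Lpath x m) (Lpath y n)) ->
  exists c : E, [/\ m + n = deg c, Lpath (gact n c) m = Lpath x m
                  & Lpath c n = Lpath y n].
Proof.
move=> [c]; rewrite /qmul /=; case: eqP => // yx [Pyc arr tgt].
have len : m + n = deg c.
  by rewrite -(size_class_seq Lset c (deg c)) -arr size_cat !size_class_seq.
move: arr; rewrite -len class_seqD => /eqP.
rewrite eqseq_cat ?size_class_seq // => /andP[/eqP arrx /eqP arry].
exists c; split=> //; last first.
  by congr QPath => //; exact/esym/Pcl_gact_of_class_seq.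
congr QPath => //; last by rewrite gact_nat len -tgt.
by rewrite -yx; exact/esym/Pcl_gact_of_class_seq.
Qed.

(** This translates (f7) into the language of (sf7): the closures only replace
    standard sequences by others with the same path, and s^ precedes s in the
    special path at the base of s^. *)
Lemma mem_complement_closure (E : fBC) (p t : prestd E) :
  std_closure (@rhat E @` std_closure [set lhat p]) t <->
  standard t /\ special_path (qmul (std_path (lhat p)) (std_path t)).
Proof.
split.
  move=> [std_t [_ [s [std_s [_ -> sp] <-]]] ts]; split=> //.
  rewrite -sp ts /std_path /=.
  set c := gact _ _; set n := (deg _ - _)%N.
  have -> : sbase s = gact n c.
    rewrite /c /n -gactD -[LHS]gact0; congr gact.
    by move: std_s; rewrite /standard; lia.
  apply: special_qmul_Lpath; rewrite /c /n fBC3.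
  by rewrite subnKC.
move=> [std_t /special_qmul_split [c [len cp ct]]].
split=> //; exists (PreStd c (slen t)); last exact: esym.
exists (PreStd (gact (slen t) c) (slen (lhat p))).
  split; last by exists (lhat p) => //; exact: cp.
  by rewrite /standard /= fBC3 -len /= leq_addr.
rewrite /rhat /= fBC3 -len /= addKn; congr PreStd.
by rewrite -gactD -[RHS]gact0; congr gact; lia.
Qed.

(** * From (f7) to (sf7) *)

Lemma sf7_of_f7 (E : fBC) : f7 E -> sf7 E.
Proof.
move=> f7E _ _ _ _ [[e [h [j [_ _ _ -> ->]]]] _]
  [[e' [h' [j' [_ _ _ -> ->]]]] _].
move: (deg e - j)%N (deg h - j)%N (deg e' - j')%N (deg h' - j')%N => m1 m2 n1 n2.
move=> /special_qmul_split[a [len_a ap ap']] /special_qmul_split[b [len_b bq bp']].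
move=> /special_qmul_split[c [len_c cp cq']].
have lhat_a : std_path (lhat (PreStd a n1)) = Lpath e m1.
  by rewrite /std_path /lhat /= -len_a addnK.
have lhat_b : std_path (lhat (PreStd b n1)) = Lpath h m2.
  by rewrite /std_path /lhat /= -len_b addnK.
have: std_closure (@rhat E @` std_closure [set lhat (PreStd a n1)]) (PreStd c n2).
  apply/mem_complement_closure; rewrite lhat_a /standard /std_path /=.
  by rewrite -len_c leq_addl -cp; split=> //; exact: special_qmul_Lpath.
rewrite (f7E _ (PreStd b n1)).
- by move=> /mem_complement_closure[_]; rewrite lhat_b /std_path /= cq'.
- by rewrite /standard /= -len_a leq_addl.
- by rewrite /standard /= -len_b leq_addl.
- by rewrite /std_equiv /std_path /= ap' bp'.
Qed.

(** * From (sf7) to (f7) in the symmetric case *)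

Lemma lhatK (E : fBC) (p : prestd E) :
  symmetric_fBC E -> standard p -> lhat (lhat p) = p.
Proof.
case: p => e n symE; rewrite /standard /lhat /= => n_le.
by rewrite fBC3 gact_nat subnK // symE subKn.
Qed.

Lemma standard_lhat (E : fBC) (p : prestd E) : standard (lhat p).
Proof. by rewrite /standard /= fBC3 leq_subr. Qed.

Lemma special_lhat_mul (E : fBC) (p : prestd E) :
  standard p -> special_path (qmul (std_path (lhat p)) (std_path p)).
Proof. by move=> std_p; apply: special_qmul_Lpath; rewrite subnK. Qed.

(** If q were shorter than d of its base, the special path L(p) = L(q) would be
    a proper piece of the special path at the base of q, against (f6). *)
Lemma full_std_equiv (E : fBC) (p q : prestd E) :
  standard q -> std_equiv p q ->
  slen p = deg (sbase p) -> slen q = deg (sbase q).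
Proof.
case: p q => [a n] [b n']; rewrite /standard /std_equiv /std_path /=.
move=> + pq full; have len := Lpath_eq_len pq.
rewrite -len in pq * => n_le; rewrite full.
have [//|ne] := eqVneq (deg a) (deg b).
have [_ arr _] := pq; have [] := @fBC6 E a b; split.
  rewrite -full arr -(subnK n_le) class_seqD; exact: suffix_infix.
move=> /(congr1 size); rewrite !size_class_seq => /eqP; exact/negP.
Qed.

(** Two standard sequences with the same left complement give a relation (R1),
    the common complement being the part that (R1) cuts off: by symmetry its
    arrows are the last ones before g^d(e) returns to e. If one of the
    sequences has length 0, its complement is a special path, so the other has
    length 0 as well and both paths are trivial at the same vertex. *)
Lemma equiv_or_type1_of_equiv_lhat (E : fBC) (p q : prestd E) :
  symmetric_fBC E -> standard p -> standard q -> std_equiv (lhat p) (lhat q) ->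
  std_path p = std_path q \/ type1_relation (std_path p) (std_path q).
Proof.
move=> symE std_p std_q pq.
have Peq : Pcl (sbase p) = Pcl (sbase q).
  by move: pq => [_ _] /=; rewrite !gact_nat !subnK // !symE.
have null (r s : prestd E) : standard s -> std_equiv (lhat r) (lhat s) ->
    slen r = 0 -> slen s = 0.
  move=> std_s rs r0.
  have := full_std_equiv (standard_lhat s) rs; rewrite /= !fBC3 r0 subn0.
  by move: std_s; rewrite /standard => + /(_ erefl); have := deg_gt0 (sbase s); lia.
have [p0|p_gt0] := posnP (slen p).
  by left; rewrite /std_path /Lpath p0 (null _ _ std_q pq p0) !gact0 Peq.
have q_gt0 : 0 < slen q.
  by rewrite lt0n; apply: contraTneq p_gt0 => /(null _ _ std_p (esym pq)) ->.
right; exists (sbase p), (sbase q), (deg (sbase p) - slen p)%N.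
have len : (deg (sbase p) - slen p = deg (sbase q) - slen q)%N.
  exact: Lpath_eq_len pq.
have len_q : (deg (sbase q) - (deg (sbase p) - slen p) = slen q)%N.
  by rewrite len subKn.
rewrite subKn // len_q; split=> //.
  by rewrite /standard in std_p std_q; lia.
move=> i /andP[i_gt0 i_le].
have /Lpath_eq_Lcl : Lpath (gact (slen p) (sbase p)) (deg (sbase p) - slen p)
    = Lpath (gact (slen q) (sbase q)) (deg (sbase p) - slen p).
  by move: pq; rewrite /std_equiv /std_path /= -len.
move=> /(_ (deg (sbase p) - slen p - i)%N); rewrite !gact_nat => pq_i.
have -> : ((deg (sbase p))%:Z - i%:Z)%R = (deg (sbase p) - slen p - i + slen p)%N.
  by rewrite /standard in std_p std_q; lia.
have -> : ((deg (sbase q))%:Z - i%:Z)%R = (deg (sbase p) - slen p - i + slen q)%N.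
  by rewrite /standard in std_p std_q; lia.
by apply: pq_i; lia.
Qed.

(** The core of the converse: (sf7) applied to the pairs L(^p), L(^q) and
    L(p), L(t). A zero relation makes two of the products L(^p)L(p), L(^q)L(p),
    L(^p)L(t), L(^q)L(t) coincide with the other two, and the claim is then one
    of the known cases. *)
Lemma special_lhat_transfer (E : fBC) (p q t : prestd E) :
  symmetric_fBC E -> sf7 E -> standard p -> standard q -> std_equiv p q ->
  special_path (qmul (std_path (lhat p)) (std_path t)) ->
  special_path (qmul (std_path (lhat q)) (std_path t)).
Proof.
move=> symE sf7E std_p std_q pq pt.
have [eq_hat|ne_hat] := EM (std_path (lhat p) = std_path (lhat q)).
  by rewrite -eq_hat.
have qp : special_path (qmul (std_path (lhat q)) (std_path p)).
  by rewrite pq; exact: special_lhat_mul.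
have [eq_pt|ne_pt] := EM (std_path p = std_path t); first by rewrite -eq_pt.
have rel_hat : type1_relation (std_path (lhat p)) (std_path (lhat q)).
  have := equiv_or_type1_of_equiv_lhat symE (standard_lhat p) (standard_lhat q).
  by rewrite !lhatK // => /(_ pq) [].
have rel : type1_relation (std_path p) (std_path t).
  (* The standard sequence t has the path required, but its own left complement
     may be another one than that of p; the sequence of the same length based
     where the special path L(^p)L(t) starts has the complement needed. *)
  have [c [len cp ct]] := special_qmul_split pt.
  have [|||//] := @equiv_or_type1_of_equiv_lhat E p (PreStd c (slen t)) symE std_p.
  - by rewrite /standard /= -len leq_addl.
  - by rewrite /std_equiv {2}/std_path /lhat /= -len addnK; exact: esym.
  - by rewrite [std_path (PreStd _ _)]ct.
  by rewrite [std_path (PreStd _ _)]ct.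
by apply: sf7E (special_lhat_mul std_p) qp pt; split.
Qed.

Lemma f7_of_sf7 (E : fBC) : symmetric_fBC E -> sf7 E -> f7 E.
Proof.
move=> symE sf7E p q std_p std_q pq; apply/seteqP; split=> t
  /mem_complement_closure[std_t pt]; apply/mem_complement_closure; split=> //.
  exact: special_lhat_transfer pt.
by apply: special_lhat_transfer pt => //; exact: esym.
Qed.

Theorem lemma2p15 (E : fBC) :
  (f7 E -> sf7 E) /\ (symmetric_fBC E -> sf7 E -> f7 E).
Proof. by split; [exact: sf7_of_f7 | exact: f7_of_sf7]. Qed.
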